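(* For Boolean functions $f:\{-1,+1\}^n\to\{-1,+1\}$, the quantity $\log_2\mu(f)$ is a rational function of the Fourier coefficients $\{\hat f(S)\}_{S\subseteq[n]}$, involving division by $(1+\mathrm{Inf}_\ell(f))$, but is not expressible as a polynomial in those coefficients. Consequently, $\mu(f)=2^{\log_2\mu(f)}$ is algebraic (a power of $2$ with rational exponent), not itself a rational function of Fourier data. (Here ''not polynomial'' means not representable as a polynomial identity in the formal Fourier variables on an open domain; on any finite $n$-variable Boolean-function universe, arbitrary invariants can be interpolated by high-degree polynomials in finitely many sample values.)
   Context: $[n]=\{1,\dots,n\}$. For a Boolean function $f:\{-1,+1\}^n\to\{-1,+1\}$ and $S\subseteq[n]$, the Fourier coefficient is $\hat f(S)=\mathbb{E}_x[f(x)\prod_{i\in S}x_i]$ with $x$ uniform on $\{-1,+1\}^n$. The influence of coordinate $\ell$ is $\mathrm{Inf}_\ell(f)=\Pr_x[f(x)\ne f(x^{\oplus\ell})]=\sum_{S\ni\ell}\hat f(S)^2$ ($x^{\oplus\ell}$ is $x$ with coordinate $\ell$ flipped). The BBT contraction invariant is $\mu(f)=\prod_{\ell=1}^n 2^{-\mathrm{Inf}_\ell(f)/(1+\mathrm{Inf}_\ell(f))}$, so that $\log_2\mu(f)=-\sum_{\ell=1}^n \mathrm{Inf}_\ell(f)/(1+\mathrm{Inf}_\ell(f))$. *)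

(* Defs.v *)
From HB Require Import structures.
From mathcomp Require Import all_boot all_order all_algebra.
From mathcomp Require Import all_classical all_reals all_analysis.
(* The notations of [mpoly] clash with those of MathComp-Analysis. *)
From mathcomp Require Import (canonicals) mpoly.

Set Implicit Arguments.
Unset Strict Implicit.
Unset Printing Implicit Defensive.

Import Order.TTheory GRing.Theory Num.Theory.
Import numFieldNormedType.Exports.
Local Open Scope ring_scope.

(* A bit b stands for the sign (-1)^b, so the points of [cube n] are those of
   {-1,+1}^n and a [boolfun n] is a function {-1,+1}^n -> {-1,+1}. *)
Definition cube (n : nat) : finType := {ffun 'I_n -> bool}.
Definition boolfun (n : nat) : Type := {ffun cube n -> bool}.

Section BooleanFunctions.
Variables (R : realType) (n : nat).
Implicit Types (f : boolfun n) (x : cube n) (S : {set 'I_n}) (l : 'I_n).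

Definition sgn (b : bool) : R := (-1) ^+ b.

Definition expect (g : cube n -> R) : R := (\sum_x g x) / #|cube n|%:R.

Definition prob (A : pred (cube n)) : R := #|A|%:R / #|cube n|%:R.

Definition fourier f S : R :=
  expect (fun x => sgn (f x) * \prod_(i in S) sgn (x i)).

Definition flip l x : cube n := [ffun i => if i == l then ~~ x i else x i].

Definition influence f l : R := prob (fun x => f x != f (flip l x)).

Definition mu f : R :=
  \prod_(l < n) 2 `^ (- (influence f l / (1 + influence f l))).

End BooleanFunctions.

Definition log2 (R : realType) (a : R) : R := ln a / ln 2.

(* There is one formal Fourier variable X_S for each S, at index [enum_rank S]. *)
Definition fdim (n : nat) : nat := #|{set 'I_n}|.

Section FormalFourierVariables.
Variables (R : realType) (n : nat).
Local Notation fpoly := (mpoly.mpoly (fdim n) R).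
Local Notation fspace := 'rV[R]_(fdim n).

Definition fvar (S : {set 'I_n}) : fpoly :=
  mpoly.mpolyX R (mpoly.mnm1 (enum_rank S)).

Definition peval (p : fpoly) (v : fspace) : R :=
  mpoly.meval (fun i => v 0 i) p.

Definition fourier_vec (f : boolfun n) : fspace :=
  \row_i fourier R f (enum_val i).

Definition formal_inf (l : 'I_n) : fpoly :=
  \sum_(S : {set 'I_n} | l \in S) fvar S ^+ 2.

(* The defining formula of [mu] in the formal Fourier variables; its exponents
   are defined everywhere because the formal influences are sums of squares. *)
Definition formal_mu (v : fspace) : R :=
  \prod_(l < n)
    2 `^ (- (peval (formal_inf l) v / (1 + peval (formal_inf l) v))).

Definition polynomial_on (U : set fspace) (F : fspace -> R) :=
  exists P : fpoly, forall v, U v -> F v = peval P v.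

Definition quotient_on (U : set fspace) (F : fspace -> R)
    (P Q : fpoly) :=
  forall v, U v -> peval Q v != 0 /\ F v = peval P v / peval Q v.

Definition rational_on (U : set fspace) (F : fspace -> R) :=
  exists P Q : fpoly, quotient_on U F P Q.

End FormalFourierVariables.

(* Main.v *)
(* On the coordinate line of the formal variable X_{l}, the formal influence of
   l is A + s^2 and the other influences are constant.  There log2 mu is
   c + 1/(a + s^2) with a > 0, which is not a polynomial.  If
   mu = 2^(c + 1/(a + s^2)) were P/Q, the logarithmic derivative of P/Q would
   have a double pole along the irreducible polynomial X^2 + a, although a
   logarithmic derivative only has simple poles.
   Parseval, applied to (f(x) - f(x^l))/2, turns influences into sums of squared
   Fourier coefficients.  Fourier inversion makes f |-> (f^(S))_S injective, so
   that Lagrange interpolation applies. *)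
Require Import Defs.
From HB Require Import structures.
From mathcomp Require Import all_boot all_order all_algebra.
From mathcomp Require Import all_classical all_reals all_analysis.
From mathcomp Require Import (canonicals) mpoly.
From mathcomp Require Import ring lra.
Import Order.TTheory GRing.Theory Num.Theory.
Import numFieldNormedType.Exports.
Local Open Scope classical_set_scope.
Local Open Scope ring_scope.

(** * One-variable obstructions: poles of polynomials and logarithmic derivatives *)

(** A nonzero [p] has fewer roots than [size p], while the ball around [s0] supplies [size p]
    distinct ones. *)
Lemma poly_eq0_near (R : realType) (p : {poly R}) (s0 : R) :
  (\forall s \near s0, p.[s] = 0) -> p = 0.
Proof.
move=> /nbhs_ballP[e /= e0 ball0].
apply/eqP/negPn/negP => p0.
(* Denominators start at 2, which keeps the points strictly inside the ball of radius [e]. *)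
pose rs := [seq s0 + e / i.+2%:R | i <- iota 0 (size p)].
suff: (size rs < size p)%N by rewrite size_map size_iota ltnn.
apply: max_poly_roots => //.
- apply/allP => _ /mapP[i _ ->]; apply/eqP/ball0.
  rewrite /ball /= opprD addrA subrr sub0r normrN gtr0_norm ?divr_gt0//.
  by rewrite ltr_pdivrMr ?ltr0n// ltr_pMr// ltr1n.
- rewrite map_inj_uniq ?iota_uniq// => i j /addrI/(mulfI (lt0r_neq0 e0)).
  by move=> /invr_inj/eqP; rewrite eqr_nat => /eqP[].
Qed.

Lemma sqrX_addC_irreducible {R : realType} (a : R) : 0 < a ->
  irreducible_poly ('X^2 + a%:P).
Proof.
move=> a0; apply: cubic_irreducible.
  by rewrite size_polyDl size_polyXn// ltnS size_polyC; case: eqP.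
by move=> x; rewrite /root !hornerE gt_eqF// ltr_wpDl// exprn_even_ge0.
Qed.

(* If P/Q satisfies the equation, its logarithmic derivative is W / D^2 with W
   coprime to D, although a logarithmic derivative only has simple poles.
   Removing a factor D from P or Q changes W by a multiple of D only. *)
Lemma log_derivative_no_double_pole (R : realType) (D W P Q : {poly R}) :
  irreducible_poly D -> ~~ (D %| W) -> P != 0 -> Q != 0 ->
  D ^+ 2 * (P^`() * Q - P * Q^`()) <> W * (P * Q).
Proof.
move=> irrD; have D0 := irredp_neq0 irrD.
have [m] := ubnP (size P + size Q)%N.
elim: m => // m IHm in W P Q *; rewrite ltnS => sPQ nDW P0 Q0 E.
have sD (A : {poly R}) : A != 0 -> (size A < size (A * D)%R)%N.
  move=> A0; have [sD1 _] := irrD; rewrite size_mul//.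
  by case: (size D) sD1 => [|[|k]] // _; rewrite !addnS /= ltnS leq_addr.
(* [D] divides the left side of [E] and is coprime to [W]. Being irreducible, it then divides [P] or
   [Q], and the induction continues with the smaller quotient. *)
have: D %| P * Q.
  rewrite -(@Gauss_dvdpr _ _ W) ?irreducible_poly_coprime//.
  by rewrite -E expr2 -mulrA dvdp_mulIl.
have [|nDP] := boolP (D %| P).
  move=> /dvdpP[A PE] _.
  have A0 : A != 0 by apply: contra_neq P0; rewrite PE => ->; rewrite mul0r.
  apply: (IHm (W - D * D^`()) A Q) => //.
  - by apply: leq_trans sPQ; rewrite ltn_add2r PE sD.
  - by rewrite dvdp_subl// dvdp_mulIl.
  - apply: (mulfI D0); move: E; rewrite PE derivM => E.
    have -> : D * ((W - D * D^`()) * (A * Q)) =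
      W * (A * D * Q) - D ^+ 2 * D^`() * A * Q by ring.
    by rewrite -E; ring.
rewrite Gauss_dvdpr ?irreducible_poly_coprime// => /dvdpP[A QE].
have A0 : A != 0 by apply: contra_neq Q0; rewrite QE => ->; rewrite mul0r.
apply: (IHm (W + D * D^`()) P A) => //.
- by apply: leq_trans sPQ; rewrite ltn_add2l QE sD.
- by rewrite dvdp_addl// dvdp_mulIl.
- apply: (mulfI D0); move: E; rewrite QE derivM => E.
  have -> : D * ((W + D * D^`()) * (P * A)) =
    W * (P * (A * D)) + D ^+ 2 * D^`() * P * A by ring.
  by rewrite -E; ring.
Qed.

(** Clearing the denominator would make X^2 + a a divisor of 1. *)
Lemma inv_quadratic_not_polynomial (R : realType) (a c s0 : R) (p : {poly R}) :
  0 < a -> ~ \forall s \near s0, c + (a + s ^+ 2)^-1 = p.[s].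
Proof.
move=> a0 pE.
have : (p - c%:P) * ('X^2 + a%:P) - 1 = 0.
  apply: (@poly_eq0_near _ _ s0); near=> s.
  rewrite !hornerE; have <- : c + (a + s ^+ 2)^-1 = p.[s] by near: s.
  rewrite addrAC subrr add0r (addrC a) mulVf ?subrr//.
  by rewrite gt_eqF// ltr_wpDl// exprn_even_ge0.
move=> /eqP; rewrite subr_eq0 => /eqP E.
have [D1 _] := sqrX_addC_irreducible _ a0.
suff /dvdp_leq : 'X^2 + a%:P %| (1 : {poly R}).
  by rewrite oner_eq0 size_poly1 leqNgt D1 => /(_ isT).
by rewrite -E dvdp_mulIr.
Unshelve. all: by end_near.
Qed.

(** With D = X^2 + a, differentiating P = Q exp(c + b/D) gives D^2 (P' Q - P Q') = -b D' P Q near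
    [s0], hence as polynomials. For degree reasons [D] does not divide -b D'. *)
Lemma exp_inv_quadratic_not_rational (R : realType) (a b c s0 : R)
    (P Q : {poly R}) : 0 < a -> b != 0 ->
  ~ \forall s \near s0,
      Q.[s] != 0 /\ expR (c + b / (a + s ^+ 2)) = P.[s] / Q.[s].
Proof.
move=> a0 b0 PQ.
have [Qs0 Es0] := nbhs_singleton PQ.
have Q0 : Q != 0 by apply: contra_neq Qs0 => ->; rewrite horner0.
have P0 : P != 0.
  apply/eqP => P0; have := expR_gt0 (c + b / (a + s0 ^+ 2)).
  by rewrite Es0 P0 horner0 mul0r ltxx.
pose D : {poly R} := 'X^2 + a%:P.
have irrD : irreducible_poly D by exact: sqrX_addC_irreducible.
have DE s : D.[s] = a + s ^+ 2 by rewrite !hornerE addrC.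
have Dgt0 s : 0 < D.[s] by rewrite DE ltr_pwDl// exprn_even_ge0.
have nDD' : ~~ (D %| - b *: D^`()).
  rewrite dvdpZr ?oppr_eq0// gtNdvdp// ?lt_size_deriv ?(irredp_neq0 irrD)//.
  rewrite derivD derivC addr0 derivXn /=.
  by apply/eqP => /(congr1 (horner^~ 1)); rewrite !hornerE; lra.
clearbody D.
apply: (log_derivative_no_double_pole _ D (- b *: D^`()) P Q irrD) => //.
apply/eqP; rewrite -subr_eq0; apply/eqP.
apply: (@poly_eq0_near _ _ s0).
near=> s.
(* Differentiating at [s] requires the equation on a whole neighbourhood of [s]. *)
have PQs : \forall s \near s,
    Q.[s] != 0 /\ expR (c + b / (a + s ^+ 2)) = P.[s] / Q.[s].
  by near: s; apply: (near_join PQ).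
have [Qs Es] := nbhs_singleton PQs.
have dV : is_derive s 1 (fun t => D.[t]^-1) (- D.[s] ^- 2 *: D^`().[s]).
  exact: is_deriveV (lt0r_neq0 (Dgt0 s)) (is_derive_poly D s).
have dA := is_deriveD (is_derive_cst c s 1) (is_deriveZ b dV).
have dE := is_derive1_comp (is_derive_expR _) dA.
have dQE := is_deriveM (is_derive_poly Q s) dE.
have PE : (\forall t \near s, P.[t] =
    (horner Q * (expR \o (cst c + b \*: (fun t => D.[t]^-1)))) t).
  near=> t.
  have [Qt Et] : Q.[t] != 0 /\ expR (c + b / (a + t ^+ 2)) = P.[t] / Q.[t].
    by near: t.
  transitivity (Q.[t] * expR (c + b / D.[t])) => //.
  by rewrite DE Et mulrCA mulfV ?mulr1.
rewrite !(hornerD, hornerN, hornerM, hornerZ, horner_exp).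
have -> : P^`().[s] =
    Q.[s] * (P.[s] / Q.[s] * (b * (- D.[s] ^- 2 * D^`().[s]))) +
    P.[s] / Q.[s] * Q^`().[s].
  (* The summand 0 is the derivative of the constant [c]. *)
  rewrite -Es -DE -[b * (- _ * _)]add0r.
  rewrite -(@derive_val _ _ _ _ _ _ _
    (near_eq_is_derive PE (is_derive_poly P s))).
  exact: (@derive_val _ _ _ _ _ _ _ dQE).
by move: D.[s] (lt0r_neq0 (Dgt0 s)) Q.[s] Qs => d d0 q q0; field; rewrite d0 q0.
Unshelve. all: by end_near.
Qed.

(** * Restriction to coordinate lines of the formal Fourier space *)

Definition set_coord {R : realType} {m : nat} (v : 'rV[R]_m) (i : 'I_m)
    (s : R) : 'rV[R]_m :=
  \row_j (if j == i then s else v 0 j).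

Lemma set_coord_near {R : realType} {m : nat} (U : set 'rV[R]_m)
    (v : 'rV[R]_m) (i : 'I_m) :
  open U -> U v -> \forall s \near v 0 i, U (set_coord v i s).
Proof.
rewrite openE => Uopen /Uopen /nbhs_ballP[e /= e0 ballU].
apply/nbhs_ballP; exists e => //= s vs; apply: ballU.
split=> // i' j; rewrite mxE (ord1 i'); case: eqP => [->//|_]; exact: ballxx.
Qed.

Lemma peval_set_coord {R : realType} {n : nat}
    (P : mpoly.mpoly (fdim n) R) (v : 'rV[R]_(fdim n)) (i : 'I_(fdim n)) :
  exists p : {poly R}, forall s, peval P (set_coord v i s) = p.[s].
Proof.
exists (mpoly.mmap polyC (fun j => if j == i then 'X else (v 0 j)%:P) P) => s.
rewrite /peval /mpoly.meval /mpoly.mmap horner_sum; apply: eq_bigr => m _.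
rewrite hornerM hornerC /mpoly.mmap1 horner_prod; congr (_ * _).
apply: eq_bigr => j _; rewrite horner_exp mxE.
by case: eqP => _; rewrite ?hornerX ?hornerC.
Qed.

Lemma peval_formal_inf {R : realType} {n : nat} (l : 'I_n)
    (v : 'rV[R]_(fdim n)) :
  peval (formal_inf R l) v =
  \sum_(S : {set 'I_n} | l \in S) v 0 (enum_rank S) ^+ 2.
Proof.
rewrite /peval /formal_inf rmorph_sum; apply: eq_bigr => S _.
by rewrite rmorphXn /= /fvar mpoly.mevalXU.
Qed.

Lemma peval_formal_inf_ge0 {R : realType} {n : nat} (l : 'I_n)
    (v : 'rV[R]_(fdim n)) :
  0 <= peval (formal_inf R l) v.
Proof. by rewrite peval_formal_inf; apply: sumr_ge0 => S _; exact: sqr_ge0. Qed.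

Lemma log2_formal_mu {R : realType} {n : nat} (v : 'rV[R]_(fdim n)) :
  log2 (formal_mu v) =
  - \sum_(l < n) peval (formal_inf R l) v / (1 + peval (formal_inf R l) v).
Proof.
have ln2 : ln 2 != 0 :> R by rewrite gt_eqF// ln_gt0// ltr1n.
rewrite /log2 /formal_mu.
have -> : forall x : 'I_n -> R, \prod_l 2 `^ (- x l) = 2 `^ (- \sum_l x l) :> R.
  move=> x; rewrite -sumrN; apply/esym.
  by apply: (big_morph (powR 2) _ (powRr0 2)) => a b;
    rewrite powRD// pnatr_eq0 implybT.
by rewrite ln_powR mulfK.
Qed.

Lemma formal_mu_gt0 {R : realType} {n : nat} (v : 'rV[R]_(fdim n)) :
  0 < formal_mu v.
Proof. by apply: prodr_gt0 => l _; rewrite powR_gt0. Qed.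

Lemma log2K {R : realType} (x : R) : 0 < x -> 2 `^ log2 x = x.
Proof.
move=> x0; rewrite /log2 /powR pnatr_eq0 /= divfK ?lnK ?posrE//.
by rewrite gt_eqF// ln_gt0// ltr1n.
Qed.

(* Only the influence of [l] involves the formal variable of [{l}]. *)
Lemma log2_formal_mu_set_coord {R : realType} {n : nat} (v : 'rV[R]_(fdim n))
    (l : 'I_n) :
  exists c a : R, 0 < a /\ forall s,
    log2 (formal_mu (set_coord v (enum_rank [set l]%SET) s)) =
    c + (a + s ^+ 2)^-1.
Proof.
pose I k := peval (formal_inf R k) v.
pose A := \sum_(S : {set 'I_n} | (l \in S) && (S != [set l]%SET))
  v 0 (enum_rank S) ^+ 2.
have A0 : 0 <= A by apply: sumr_ge0 => S _; exact: sqr_ge0.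
exists (- (1 + \sum_(k < n | k != l) I k / (1 + I k))), (1 + A).
split=> [|s]; first by rewrite ltr_pwDl.
pose w := set_coord v (enum_rank [set l]%SET) s; rewrite -/w.
have Il : peval (formal_inf R l) w = A + s ^+ 2.
  rewrite peval_formal_inf (bigD1 [set l]%SET) ?set11//= mxE eqxx addrC.
  congr (_ + _); apply: eq_bigr => S /andP[_ Sl].
  by rewrite mxE (inj_eq enum_rank_inj) (negbTE Sl).
have Ik k : k != l -> peval (formal_inf R k) w = I k.
  move=> kl; rewrite /I !peval_formal_inf; apply: eq_bigr => S kS.
  rewrite mxE (inj_eq enum_rank_inj); case: eqP => // SE.
  by move: kS; rewrite SE inE (negbTE kl).
rewrite log2_formal_mu (bigD1 l)//= Il.
under eq_bigr => k kl do rewrite Ik//.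
have D0 : 1 + A + s ^+ 2 != 0.
  by rewrite gt_eqF// -addrA ltr_pwDl// addr_ge0// sqr_ge0.
by field; rewrite D0.
Qed.

Lemma log2_formal_mu_not_polynomial {R : realType} {n : nat}
    (U : set 'rV[R]_(fdim n)) :
  (0 < n)%N -> open U -> U !=set0 ->
  ~ polynomial_on U (fun v => log2 (formal_mu v)).
Proof.
move=> n0 Uopen [v Uv] [P PE]; pose i := enum_rank [set Ordinal n0]%SET.
have [c [a [a0 cE]]] := log2_formal_mu_set_coord v (Ordinal n0).
have [p pE] := peval_set_coord P v i.
apply: (inv_quadratic_not_polynomial R a c (v 0 i) p a0).
by apply: filterS (set_coord_near _ _ i Uopen Uv) => s Us; rewrite -cE -pE PE.
Qed.

Lemma formal_mu_not_rational {R : realType} {n : nat}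
    (U : set 'rV[R]_(fdim n)) :
  (0 < n)%N -> open U -> U !=set0 -> ~ rational_on U (@formal_mu R n).
Proof.
move=> n0 Uopen [v Uv] [P [Q PQE]]; pose i := enum_rank [set Ordinal n0]%SET.
have [c [a [a0 cE]]] := log2_formal_mu_set_coord v (Ordinal n0).
have [p pE] := peval_set_coord P v i; have [q qE] := peval_set_coord Q v i.
have ln2 : ln 2 != 0 :> R by rewrite gt_eqF// ln_gt0// ltr1n.
(* Since 2^y = exp(y ln 2), the exponent c + 1/(a + s^2) is multiplied by [ln 2]. *)
apply: (exp_inv_quadratic_not_rational R a (ln 2) (c * ln 2) (v 0 i) p q
  a0 ln2).
apply: filterS (set_coord_near _ _ i Uopen Uv) => s /PQE[Q0 PQ].
rewrite -qE -pE; split=> //; rewrite -PQ -[RHS]log2K ?formal_mu_gt0// cE.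
by rewrite /powR pnatr_eq0 /= mulrDl [_^-1 * _]mulrC.
Qed.

(** * Fourier analysis on the cube *)

Definition walsh (R : realType) {n : nat} (S : {set 'I_n}) (x : cube n) : R :=
  \prod_(i in S) sgn R (x i).

(** Real-valued [g] are allowed because (f(x) - f(x^l))/2 also takes the value 0. *)
Definition walsh_coef {R : realType} {n : nat} (g : cube n -> R)
    (S : {set 'I_n}) : R :=
  expect (fun x => g x * walsh R S x).

Lemma card_cube_neq0 (R : realType) (n : nat) : #|cube n|%:R != 0 :> R.
Proof.
rewrite pnatr_eq0 -lt0n; apply/card_gt0P; by exists [ffun=> false].
Qed.

(** The sum over [S] expands a product over coordinates whose factors are 2 where the bits agree and
    0 where they differ. *)
Lemma sum_walshM {R : realType} {n : nat} (x y : cube n) :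
  \sum_(S : {set 'I_n}) walsh R S x * walsh R S y = (x == y)%:R * #|cube n|%:R.
Proof.
transitivity (\prod_(i < n) (sgn R (x i) * sgn R (y i) + 1)).
  rewrite bigA_distr; apply: eq_bigr => S _.
  by rewrite /walsh -big_split /= big_mkcond.
have [->|xy] := eqVneq x y.
  under eq_bigr do rewrite /sgn -expr2 -exprM mulnC exprM sqrrN expr1n expr1n.
  rewrite prodr_const mul1r card_ord /cube card_ffun card_bool card_ord natrX.
  by rewrite -natr1.
have [i xyi] : exists i, x i != y i.
  by apply/existsP; apply: contraNT xy; rewrite negb_exists => /forallP xy;
    apply/eqP/ffunP => i; apply/eqP/negPn/xy.
rewrite (bigD1 i)//= mul0r /sgn -signr_addb.
by move: xyi; rewrite negb_eqb => ->; rewrite expr1 addNr mul0r.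
Qed.

(** Expanding the squares gives a double sum over [x] and [y], of which [sum_walshM] keeps only the
    diagonal. *)
Lemma parseval {R : realType} {n : nat} (g : cube n -> R) :
  \sum_(S : {set 'I_n}) walsh_coef g S ^+ 2 = expect (fun x => g x ^+ 2).
Proof.
have N0 := card_cube_neq0 R n; set N : R := #|_|%:R in N0 *.
transitivity (\sum_x \sum_y g x * g y *
    (\sum_(S : {set 'I_n}) walsh R S x * walsh R S y) / N ^+ 2).
  under [RHS]eq_bigr do under eq_bigr do rewrite mulr_sumr mulr_suml.
  under [RHS]eq_bigr do rewrite exchange_big /=.
  rewrite exchange_big /=; apply: eq_bigr => S _.
  rewrite /walsh_coef /expect expr_div_n expr2 !mulr_suml.
  apply: eq_bigr => x _.
  by rewrite mulr_sumr mulr_suml; apply: eq_bigr => y _; rewrite mulrACA.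
rewrite /expect mulr_suml; apply: eq_bigr => x _.
rewrite (bigD1 x)//= [X in _ + X]big1 ?addr0 => [|y yx].
  by rewrite sum_walshM eqxx mul1r -[#|_|%:R]/N; field.
by rewrite sum_walshM eq_sym (negbTE yx) mul0r mulr0 mul0r.
Qed.

Lemma walsh_inversion {R : realType} {n : nat} (g : cube n -> R) (x : cube n) :
  \sum_(S : {set 'I_n}) walsh_coef g S * walsh R S x = g x.
Proof.
have N0 := card_cube_neq0 R n; set N : R := #|_|%:R in N0 *.
transitivity (\sum_y g y *
    (\sum_(S : {set 'I_n}) walsh R S y * walsh R S x) / N).
  under [RHS]eq_bigr do rewrite mulr_sumr mulr_suml.
  rewrite exchange_big /=; apply: eq_bigr => S _.
  rewrite /walsh_coef /expect !mulr_suml; apply: eq_bigr => y _.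
  by rewrite -!mulrA [N^-1 * _]mulrC.
rewrite (bigD1 x)//= [X in _ + X]big1 ?addr0 => [|y yx]; rewrite sum_walshM.
  by rewrite eqxx mul1r mulfK.
by rewrite (negbTE yx) mul0r mulr0 mul0r.
Qed.

Lemma sgn_inj {R : realType} : injective (sgn R).
Proof. by move=> [] [] //; rewrite /sgn expr1 expr0 => E; exfalso; lra. Qed.

Lemma fourier_vecE {R : realType} {n : nat} (f : boolfun n) (S : {set 'I_n}) :
  fourier_vec R f 0 (enum_rank S) = walsh_coef (fun x => sgn R (f x)) S.
Proof. by rewrite mxE enum_rankK. Qed.

Lemma fourier_vec_inj {R : realType} {n : nat} : injective (@fourier_vec R n).
Proof.
move=> f g fg; apply/ffunP => x; apply: (@sgn_inj R).
rewrite -(walsh_inversion (fun x => sgn R (f x))).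
rewrite -(walsh_inversion (fun x => sgn R (g x))).
by apply: eq_bigr => S _; rewrite -!fourier_vecE fg.
Qed.

Lemma flipK {n : nat} (l : 'I_n) : involutive (flip l).
Proof.
by move=> x; apply/ffunP => i; rewrite !ffunE; case: eqP => // _; rewrite negbK.
Qed.

Lemma walsh_flip {R : realType} {n : nat} (l : 'I_n) (S : {set 'I_n})
    (x : cube n) :
  walsh R S (flip l x) = (-1) ^+ (l \in S) * walsh R S x.
Proof.
have flipE (i : 'I_n) : sgn R (flip l x i) = (-1) ^+ (i == l) * sgn R (x i).
  by rewrite ffunE /sgn; case: eqP => _; rewrite ?mul1r ?signrN// mulN1r.
rewrite /walsh (eq_bigr _ (fun i _ => flipE i)) big_split /=; congr (_ * _).
have [lS|lS] := boolP (l \in S).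
  rewrite (bigD1 l)//= eqxx big1 ?mulr1// => i /andP[_ il].
  by rewrite (negbTE il).
by rewrite big1// => i iS; case: eqP => // il; move: lS; rewrite -il iS.
Qed.

(** Flipping [l] negates the Walsh functions of the sets containing [l] and fixes the others, which
    therefore cancel in the difference. *)
Lemma walsh_coef_diff {R : realType} {n : nat} (g : cube n -> R)
    (l : 'I_n) (S : {set 'I_n}) :
  walsh_coef (fun x => (g x - g (flip l x)) / 2) S =
  if l \in S then walsh_coef g S else 0.
Proof.
have flipS : \sum_x g (flip l x) * walsh R S x =
    (-1) ^+ (l \in S) * \sum_x g x * walsh R S x.
  rewrite (reindex_inj (inv_inj (flipK l))) mulr_sumr; apply: eq_bigr => x _.
  by rewrite flipK walsh_flip mulrCA.
rewrite /walsh_coef /expect.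
under eq_bigr do rewrite mulrAC mulrBl.
rewrite -mulr_suml sumrB flipS.
by case: ifP => _; rewrite ?mulN1r ?opprK ?mul1r ?subrr ?mul0r//; field;
  exact: card_cube_neq0.
Qed.

Lemma influence_fourier_vec {R : realType} {n : nat} (f : boolfun n)
    (l : 'I_n) :
  influence R f l = peval (formal_inf R l) (fourier_vec R f).
Proof.
rewrite peval_formal_inf big_mkcond /=.
(* The square of (f(x) - f(x^l))/2 is the indicator of f(x) != f(x^l), so its expectation is the
   influence. *)
transitivity (\sum_(S : {set 'I_n})
    walsh_coef (fun x => (sgn R (f x) - sgn R (f (flip l x))) / 2) S ^+ 2).
  rewrite parseval /influence /prob /expect; congr (_ / _).
  rewrite -sum1_card natr_sum big_mkcond /=; apply: eq_bigr => x _.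
  rewrite unfold_in /= /sgn.
  have half2 : (1 + 1) / 2 = 1 :> R by rewrite divff ?pnatr_eq0.
  case: (f x) (f (flip l x)) => [] [] /=; rewrite ?expr0 ?expr1.
  - by rewrite subrr mul0r expr0n.
  - by rewrite -opprD mulNr sqrrN half2 expr1n.
  - by rewrite opprK half2 expr1n.
  - by rewrite subrr mul0r expr0n.
apply: eq_bigr => S _; rewrite (walsh_coef_diff (fun x => sgn R (f x))).
by case: ifP => _; rewrite ?expr0n ?fourier_vecE.
Qed.

Lemma mu_fourier_vec {R : realType} {n : nat} (f : boolfun n) :
  mu R f = formal_mu (fourier_vec R f).
Proof. by apply: eq_bigr => l _; rewrite influence_fourier_vec. Qed.

(** * Interpolation on finite sets of points *)

(** The Lagrange basis polynomial of [t] is a product over the other [u] of factors affine in a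
    coordinate where [v t] and [v u] differ. *)
Lemma multivariate_interpolation {R : realType} {n : nat} {T : finType}
    (v : T -> 'rV[R]_(fdim n)) (g : T -> R) : injective v ->
  exists P : mpoly.mpoly (fdim n) R, forall t, g t = peval P (v t).
Proof.
move=> v_inj.
have sep t u : exists L : mpoly.mpoly (fdim n) R,
    u != t -> peval L (v t) = 1 /\ peval L (v u) = 0.
  (* Nothing is required for u = t, where 0 is a placeholder. *)
  have [->|ut] := eqVneq u t; first by exists 0.
  have [j vj] : exists j, v t 0 j != v u 0 j.
    apply/existsP; apply: contraNT ut; rewrite negb_exists => /forallP vE.
    by apply/eqP/v_inj/rowP => j; apply/esym/eqP/negPn/vE.
  exists (mpoly.mpolyC _ (v t 0 j - v u 0 j)^-1 *
    (mpoly.mpolyX R (mpoly.mnm1 j) - mpoly.mpolyC _ (v u 0 j))) => _.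
  rewrite /peval !rmorphM !rmorphB /= !mpoly.mevalC !mpoly.mevalXU subrr mulr0.
  by rewrite mulVf// subr_eq0.
have [L LE] := choice (fun tu => sep tu.1 tu.2).
exists (\sum_t mpoly.mpolyC _ (g t) * \prod_(u | u != t) L (t, u)) => u.
rewrite /peval rmorph_sum (bigD1 u)//= [X in _ + X]big1 ?addr0 => [|t tu].
  rewrite rmorphM /= mpoly.mevalC rmorph_prod big1 ?mulr1// => t tu.
  by have [] := LE (u, t) tu.
rewrite rmorphM /= rmorph_prod (bigD1 u) 1?eq_sym//=.
have [|_ /= uE] := LE (t, u); first by rewrite /= eq_sym.
by move: uE; rewrite /peval => ->; rewrite mul0r mulr0.
Qed.

(** * Rationality of log2 mu and algebraicity of mu *)

(** The fractions are put over a common denominator, which vanishes nowhere because formal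
    influences are nonnegative. *)
Lemma log2_formal_mu_quotient {R : realType} {n : nat} :
  exists P, quotient_on setT (fun v => log2 (@formal_mu R n v)) P
    (\prod_(l < n) (1 + formal_inf R l)).
Proof.
exists (- \sum_(l < n) formal_inf R l *
  \prod_(k < n | k != l) (1 + formal_inf R k)).
move=> v _; pose I k := peval (formal_inf R k) v.
have I0 k : 1 + I k != 0 by rewrite gt_eqF// ltr_pwDl// peval_formal_inf_ge0.
have IE k : peval (1 + formal_inf R k) v = 1 + I k.
  by rewrite /peval rmorphD rmorph1.
have QE (A : pred 'I_n) : peval (\prod_(k < n | A k) (1 + formal_inf R k)) v =
    \prod_(k < n | A k) (1 + I k).
  by rewrite /peval rmorph_prod; apply: eq_bigr => k _; exact: IE.
rewrite QE; split; first exact/prodf_neq0.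
rewrite log2_formal_mu /peval rmorphN rmorph_sum mulNr mulr_suml /=.
congr (- _).
apply: eq_bigr => l _; rewrite -/(peval _ _) -/(I l) rmorphM /=.
rewrite -!/(peval _ _) QE -/(I l).
have -> : \prod_(k < n) (1 + I k) =
    (1 + I l) * \prod_(k < n | k != l) (1 + I k).
  by rewrite (bigD1 l).
by rewrite -mulf_div divff ?mulr1//; exact/prodf_neq0.
Qed.

Lemma influence_rat {R : realType} {n : nat} (f : boolfun n) (l : 'I_n) :
  exists q : rat, influence R f l = ratr q.
Proof.
exists (#|(fun x => f x != f (flip l x))|%:R / #|cube n|%:R).
by rewrite fmorph_div /= !ratr_nat.
Qed.

Lemma log2_mu_rat {R : realType} {n : nat} (f : boolfun n) :
  exists q : rat, log2 (mu R f) = ratr q.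
Proof.
have [q qE] := choice (@influence_rat R n f).
exists (- \sum_(l < n) q l / (1 + q l)).
rewrite mu_fourier_vec log2_formal_mu rmorphN rmorph_sum; congr (- _).
apply: eq_bigr => l _.
by rewrite -influence_fourier_vec qE fmorph_div rmorphD rmorph1.
Qed.

(** If q = k/d in lowest terms, the number is a root of X^d - 2^k, and 2^k is rational for negative
    k too. *)
Lemma pow2_rat_algebraic {R : realType} (q : rat) :
  algebraicOver (ratr : rat -> R) (2 `^ ratr q).
Proof.
have d0 : (0 < `|denq q|)%N by rewrite absz_gt0 denq_eq0.
have xd : (2 `^ ratr q : R) ^+ `|denq q| = 2 `^ (numq q)%:~R.
  rewrite -powR_mulrn ?powR_ge0// -powRrM; congr (_ `^ _).
  rewrite -{1}(divq_num_den q) fmorph_div /= !ratr_int -absz_denq divfK//.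
  by rewrite pnatr_eq0 -lt0n.
have [m mE] : exists r : rat, 2 `^ (numq q)%:~R = ratr r :> R.
  case: (numq q) => k.
    by exists (2 ^+ k); rewrite powR_mulrn// rmorphXn /= ratr_nat.
  (* [Negz k] stands for -(k + 1), hence the exponent [k.+1]. *)
  exists ((2 ^+ k.+1)^-1); rewrite NegzE mulrNz powRN powR_mulrn//.
  by rewrite fmorphV rmorphXn /= ratr_nat.
exists ('X^`|denq q| - m%:P); first by rewrite -size_poly_gt0 size_XnsubC.
by rewrite rmorphB /= map_polyXn map_polyC /= /root !hornerE xd mE subrr.
Qed.

Theorem proposition5p3 (R : realType) (n : nat) :
  [/\ (* the formal Fourier expression represents mu on Boolean functions *)
      (forall f : boolfun n, mu R f = formal_mu (fourier_vec R f)),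
      (* log2 mu is a rational function, with denominators 1 + Inf_l *)
      (forall v : 'rV[R]_(fdim n),
         log2 (formal_mu v) =
         - \sum_(l < n)
             peval (formal_inf R l) v / (1 + peval (formal_inf R l) v)) /\
      (exists P : mpoly.mpoly (fdim n) R,
         quotient_on setT (fun v => log2 (formal_mu v))
           P (\prod_(l < n) (1 + formal_inf R l)) /\
         forall f : boolfun n,
           log2 (mu R f) =
           peval P (fourier_vec R f) /
           peval (\prod_(l < n) (1 + formal_inf R l)) (fourier_vec R f)),
      (* log2 mu is not a polynomial on any nonempty open domain *)
      ((0 < n)%N -> forall U : set 'rV[R]_(fdim n), open U -> U !=set0 ->
         ~ polynomial_on U (fun v => log2 (formal_mu v))),
      (* mu f is a rational power of 2, hence algebraic, but mu is not a
         rational function on any nonempty open domain *)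
      (forall f : boolfun n,
         [/\ mu R f = 2 `^ log2 (mu R f),
             exists q : rat, log2 (mu R f) = ratr q
           & algebraicOver (ratr : rat -> R) (mu R f)]) /\
      ((0 < n)%N -> forall U : set 'rV[R]_(fdim n), open U -> U !=set0 ->
         ~ rational_on U (@formal_mu R n))
    & (* on the finite set of Boolean functions, every invariant is
         interpolated by a polynomial in the Fourier coefficients *)
      forall g : boolfun n -> R, exists P : mpoly.mpoly (fdim n) R,
        forall f : boolfun n, g f = peval P (fourier_vec R f)].
Proof.
split.
- exact: mu_fourier_vec.
- split; first exact: log2_formal_mu.
  have [P PE] := @log2_formal_mu_quotient R n; exists P; split=> // f.
  by rewrite mu_fourier_vec; have [] := PE (fourier_vec R f) I.
- by move=> n0 U; exact: log2_formal_mu_not_polynomial.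
- split; last by move=> n0 U; exact: formal_mu_not_rational.
  move=> f; have muK : 2 `^ log2 (mu R f) = mu R f.
    by rewrite log2K// mu_fourier_vec formal_mu_gt0.
  have [q qE] := @log2_mu_rat R n f.
  by split; [| exists q | rewrite -muK qE; exact: pow2_rat_algebraic].
- move=> g; exact: (multivariate_interpolation _ g fourier_vec_inj).
Qed.
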